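(* Let $\{X,\mathfrak{F}\}$ be a measurable space, $\tilde\omega$ an $\mathfrak{F}$-measurable $\mathfrak{S}(\mathcal{H})$-valued function on $X$ (integrable in the Pettis sense w.r.t. every probability measure on $X$), and $\mathfrak{Q}=\mathfrak{Q}_{X,\mathfrak{F},\tilde\omega}$ the corresponding quasi-classical set of states. Let $\mathfrak{S}_0$ be a convex subset of $\mathfrak{S}(\mathcal{H})$ with the property $$\rho\in\mathfrak{S}_0\cap\mathfrak{Q}\ \Rightarrow\ \{\sigma\in\mathfrak{Q}\,:\,\exists\,\epsilon>0,\ \epsilon\sigma\le\rho\}\subseteq\mathfrak{S}_0 .$$ Let $f$ be a function on $\mathfrak{S}_0$ taking values in $(-\infty,+\infty]$ that satisfies, for all $\rho,\sigma\in\mathfrak{S}_0$ and any $p\in[0,1]$, the inequalities $$f(p\rho+(1-p)\sigma)\ge pf(\rho)+(1-p)f(\sigma)-a_f(p),\qquad f(p\rho+(1-p)\sigma)\le pf(\rho)+(1-p)f(\sigma)+b_f(p)$$ with possible value $+\infty$ in both sides, where $a_f$ and $b_f$ are continuous functions on $[0,1]$ vanishing as $p\to+0$. Let $\rho$ and $\sigma$ be states in $\mathfrak{Q}\cap\mathfrak{S}_0$ with representing measures $\mu_\rho$ and $\mu_\sigma$ correspondingly. If $f(\rho)<+\infty$ then $$f(\rho)-f(\sigma)\le\varepsilon\,C_f(\rho,\sigma|\varepsilon)+D_f(\varepsilon),$$ where $\varepsilon=\mathrm{TV}(\mu_\rho,\mu_\sigma)$, $D_f(\varepsilon)=(1+\varepsilon)(a_f+b_f)\!\left(\frac{\varepsilon}{1+\varepsilon}\right)$,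 $$C_f(\rho,\sigma|\varepsilon)=\sup\{f(\varrho)-f(\varsigma)\,:\,\varrho,\varsigma\in\mathfrak{Q},\ \varepsilon\varrho\le\rho,\ \varepsilon\varsigma\le\sigma\},$$ and the left-hand side may be equal to $-\infty$. If the function $f$ is nonnegative, then the inequality holds with $C_f(\rho,\sigma|\varepsilon)$ replaced by $$C_f^+(\rho|\varepsilon)=\sup\{f(\varrho)\,:\,\varrho\in\mathfrak{Q},\ \varepsilon\varrho\le\rho\}.$$
   Context: $\mathcal{H}$ is a separable Hilbert space and $\mathfrak{S}(\mathcal{H})$ the set of quantum states (positive trace-class operators of unit trace) on it; $\le$ between operators is the operator order. $\mathcal{P}(X)$ is the set of probability measures on $\{X,\mathfrak{F}\}$. The quasi-classical set is $$\mathfrak{Q}_{X,\mathfrak{F},\tilde\omega}=\Big\{\rho\in\mathfrak{S}(\mathcal{H})\,:\,\exists\,\mu_\rho\in\mathcal{P}(X),\ \rho=\int_X\tilde\omega(x)\,\mu_\rho(dx)\Big\},$$ and any $\mu_\rho\in\mathcal{P}(X)$ with $\rho=\int_X\tilde\omega(x)\mu_\rho(dx)$ is called a representing measure for $\rho$. $\mathrm{TV}(\mu,\nu)=\sup_{A\in\mathfrak{F}}|\mu(A)-\nu(A)|$ is the total variation distance. *)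

(* Defs.v *)
From mathcomp Require Export all_boot all_order all_algebra.
From mathcomp Require Export sesquilinear complex.
From mathcomp Require Export all_classical all_reals all_analysis.

Set Implicit Arguments.
Unset Strict Implicit.
Unset Printing Implicit Defensive.

Export Order.TTheory GRing.Theory Num.Def Num.Theory.
Export numFieldNormedType.Exports.

Global Open Scope classical_set_scope.
Global Open Scope complex_scope.
Global Open Scope ring_scope.

(* Complex Hilbert spaces are complete normed modules over R[i] carrying a
   positive definite form dot, linear in its first argument, to be used under
   the assumption `|x| ^+ 2 = dot x x for all x.  Operators are plain
   functions H -> H, which form an R[i]-module for the pointwise operations;
   linearity and boundedness are predicates. *)

Definition separable_space (T : topologicalType) : Prop :=
  exists2 A : set T, countable A & dense A.

Section Operators.
Context {R : realType} {H : completeNormedModType R[i]}.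
Variable dot : {dot H for conjC}.

Definition orthonormal_basis (B : set H) : Prop :=
  [/\ forall e, B e -> dot e e = 1,
      forall e e', B e -> B e' -> e != e' -> dot e e' = 0
    & forall x, (forall e, B e -> dot x e = 0) -> x = 0].

Definition bounded_operator (T : H -> H) : Prop := linear T /\ continuous T.

(* In R[i], 0 <= z means that z is real and nonnegative, so that positive
   operators are automatically self-adjoint. *)
Definition positive_operator (T : H -> H) : Prop :=
  bounded_operator T /\ forall x, 0 <= dot (T x) x.

Definition operator_le (S T : H -> H) : Prop := positive_operator (T - S).

(* P = |T|, the positive square root of the operator T^* T: since P is
   self-adjoint, the equation reads P^2 = T^* T. *)
Definition operator_abs (T P : H -> H) : Prop :=
  positive_operator P /\ forall x y, dot (P x) (P y) = dot (T x) (T y).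

(* Only used for positive T.  The sum of the diagonal entries of T does not
   depend on the orthonormal basis, and orthonormal bases exist. *)
Definition positive_trace (T : H -> H) (t : \bar R) : Prop :=
  forall B : set H, orthonormal_basis B ->
    \esum_(e in B) (complex.Re (dot (T e) e))%:E = t.

(* t is the trace norm Tr |T| of the bounded operator T. *)
Definition trace_norm (T : H -> H) (t : R) : Prop :=
  bounded_operator T /\
  exists2 P, operator_abs T P & positive_trace P t%:E.

Definition trace_class (T : H -> H) : Prop := exists t : R, trace_norm T t.

Definition state : set (H -> H) :=
  [set rho | [/\ positive_operator rho, trace_class rho
               & positive_trace rho 1%E]].

(* Open subsets of the set of states for the trace norm distance. *)
Definition state_open (U : set (H -> H)) : Prop :=
  U `<=` state /\
  forall rho, U rho -> exists2 r : R, 0 < r &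
    forall sigma t, state sigma -> trace_norm (sigma - rho) t -> t < r ->
      U sigma.

Definition state_borel : set_system (H -> H) := <<s state, state_open >>.

(* Elements of the dual of the Banach space of trace-class operators; the
   values of phi outside the trace class are irrelevant. *)
Definition trace_class_dual (phi : (H -> H) -> R[i]) : Prop :=
  (forall (c : R[i]) S T, trace_class S -> trace_class T ->
     phi (c *: S + T) = c * phi S + phi T) /\
  exists C : R, forall T t, trace_norm T t -> `|phi T| <= (C * t)%:C.

Section Pettis.
Context {d : measure_display} {X : measurableType d}.

Definition state_valued_measurable (w : X -> (H -> H)) : Prop :=
  (forall x, state (w x)) /\
  forall A, state_borel A -> measurable (w @^-1` A).

Definition complex_integrable (mu : probability X R) (A : set X)
    (g : X -> R[i]) : Prop :=
  mu.-integrable A (fun x => (complex.Re (g x))%:E) /\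
  mu.-integrable A (fun x => (complex.Im (g x))%:E).

Definition complex_integral (mu : probability X R) (A : set X)
    (g : X -> R[i]) : R[i] :=
  (\int[mu]_(x in A) complex.Re (g x)) +i* (\int[mu]_(x in A) complex.Im (g x)).

(* T is the Pettis integral of w over A in the Banach space of trace-class
   operators. *)
Definition pettis_integral (mu : probability X R) (A : set X)
    (w : X -> (H -> H)) (T : H -> H) : Prop :=
  trace_class T /\
  forall phi, trace_class_dual phi ->
    complex_integrable mu A (phi \o w) /\
    phi T = complex_integral mu A (phi \o w).

Definition pettis_integrable (mu : probability X R) (w : X -> (H -> H)) : Prop :=
  forall A, measurable A -> exists T, pettis_integral mu A w T.

Definition representing_measure (w : X -> (H -> H)) (rho : H -> H)
    (mu : probability X R) : Prop :=
  pettis_integral mu setT w rho.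

Definition quasi_classical (w : X -> (H -> H)) : set (H -> H) :=
  [set rho | state rho /\ exists mu, representing_measure w rho mu].

End Pettis.

(* Here f is a total function of which only the values on a set S0 of states
   matter.  When eps > 0 and rho, sigma lie in S0, the hereditary property of
   S0 puts all the states concerned in S0; when eps = 0 the suprema are only
   used multiplied by eps, and 0 * +oo = 0 * -oo = 0 in \bar R.  Since
   +oo - +oo = -oo in \bar R, the pairs for which the difference is undefined
   do not contribute to the supremum. *)
Definition C_sup (Q : set (H -> H)) (f : (H -> H) -> \bar R)
    (rho sigma : H -> H) (eps : R) : \bar R :=
  ereal_sup [set (f p.1 - f p.2)%E | p in
    [set p : (H -> H) * (H -> H) |
       [/\ Q p.1, Q p.2, operator_le (eps%:C *: p.1) rho
         & operator_le (eps%:C *: p.2) sigma]]].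

Definition C_sup_plus (Q : set (H -> H)) (f : (H -> H) -> \bar R)
    (rho : H -> H) (eps : R) : \bar R :=
  ereal_sup [set f r | r in
    [set r : H -> H | Q r /\ operator_le (eps%:C *: r) rho]].

End Operators.

Definition TV {R : realType} {d : measure_display} {X : measurableType d}
    (mu nu : probability X R) : R :=
  sup [set `|fine (mu A) - fine (nu A)| | A in measurable].

Definition D_term {R : realType} (a b : R -> R) (eps : R) : R :=
  (1 + eps) * (a (eps / (1 + eps)) + b (eps / (1 + eps))).

(* Main.v *)
From mathcomp Require Import ring lra.
Require Import Defs.

(* Let eps = TV mu_rho mu_sigma > 0.  A Hahn decomposition of the charge
   mu_rho - mu_sigma gives mu_rho = m + jp and mu_sigma = m + jn with jp and jn
   of mass eps.  The barycenters tp and tn of jp / eps and jn / eps are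
   quasi-classical states with eps tp <= rho and eps tn <= sigma, and, for
   p = eps / (1 + eps),
     p tn + (1 - p) rho = p tp + (1 - p) sigma.
   Bounding the value of f at this state from below by the left-hand mixture
   and from above by the right-hand one gives
     f rho - f sigma <= eps (f tp - f tn) + D_f(eps).
   If eps = 0 then rho = sigma.
   Positive operators are compared through their quadratic forms, which
   determine them; T |-> <T x, x> is continuous for the trace norm, so that the
   quadratic form of a Pettis integral is a Lebesgue integral. *)

Set Implicit Arguments.
Unset Strict Implicit.
Unset Printing Implicit Defensive.

(** * Quadratic forms of operators on a complex inner product space *)

Lemma real_sum_diff_conj (C : numClosedFieldType) (u v : C) :
  u + v \is Num.real -> 'i * (v - u) \is Num.real -> v = u^*.
Proof.
move=> /CrealP uv /CrealP; rewrite (rmorphM conjC) /= conjCi mulNr -mulrN.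
move=> /(mulfI (neq0Ci _)); rewrite (rmorphB conjC) opprB => iuv.
have : v *+ 2 = u^* *+ 2.
  rewrite -[LHS]/(v + v) -[RHS]/(u^* + u^*).
  have -> : v + v = (u + v) + (v - u) by ring.
  by rewrite -uv -iuv (rmorphD conjC) /=; ring.
by move=> /eqP; rewrite eqrMn2r// => /eqP.
Qed.

Section QuadraticForms.
Context {R : realType} {H : completeNormedModType R[i]}.
Variable dot : {dot H for conjC}.
Implicit Types (T P : H -> H) (x y : H).

Lemma dotC x y : dot y x = (dot x y)^*.
Proof. by rewrite hermC expr0 mul1r. Qed.

Lemma linear_funD T : linear T -> {morph T : x y / x + y}.
Proof. by move=> linT x y; rewrite -[x]scale1r linT !scale1r. Qed.

Lemma linear_funB T : linear T -> {morph T : x y / x - y}.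
Proof. exact: zmod_morphism_linear. Qed.

Lemma linear_funZ T : linear T -> forall c, {morph T : x / c *: x}.
Proof. exact: scalable_linear. Qed.

(** Polarization: for real quadratic forms the cross terms at [x, y] and at [x, 'i *: y] are real.
    They are [u + v] and ['i * (v - u)], which forces [v = u^*]. *)
Lemma quadratic_real_hermitian T x y : linear T ->
  (forall z, dot (T z) z \is Num.real) -> dot (T y) x = (dot (T x) y)^*.
Proof.
move=> linT realT; set u := dot (T x) y; set v := dot (T y) x.
have cross_real a b : dot (T a) b + dot (T b) a \is Num.real.
  have -> : dot (T a) b + dot (T b) a =
      dot (T (a + b)) (a + b) - dot (T a) a - dot (T b) b.
    by rewrite linear_funD// linearDl !linearDr /=; ring.
  by rewrite !rpredB.
have uv := cross_real x y.
have := cross_real x ('i *: y).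
rewrite linear_funZ// linearZl_LR !linearZr_LR /= -/u -/v.
rewrite conjCi mulNr addrC -mulrBr => iuv.
exact: real_sum_diff_conj.
Qed.

Lemma dot_CauchySchwarz x y : `|dot x y| ^+ 2 <= dot x x * dot y y.
Proof.
have [->|y0] := eqVneq y 0.
  by rewrite linear0r normr0 expr0n /= mulr_ge0// dnorm_ge0.
have d0 : 0 < dot y y by rewrite dnorm_gt0.
have := dnorm_ge0 dot (dot y y *: x - dot x y *: y).
rewrite dnormB !dnormZ linearZl_LR linearZr_LR /= (ger0_norm (ltW d0)).
rewrite !(rmorphM conjC) /= conjCK (CrealP (ger0_real (ltW d0))) normCK.
set c := dot x y; set d := dot y y.
have -> : d ^+ 2 * dot x x + c * c^* * d -
    (d * (c^* * c) + d * (c * c^*)) = d * (dot x x * d - c * c^*) by ring.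
by rewrite pmulr_rge0// subr_ge0.
Qed.

(** The form of [P] at [x - s *: P x] is nonnegative for every real [s], and its coefficient of
    [s ^+ 2] is at most [t * n] by the bound on the form at [P x]. Taking [s = t^-1] gives the
    claim; if [t = 0], then [<P x, x> = 0] and [s = 1] leaves [- 2 * n >= 0]. *)
Lemma positive_operator_norm_bound P (t : R[i]) x : positive_operator dot P ->
  (forall y, dot (P y) y <= t * dot y y) ->
  0 <= t -> dot (P x) (P x) <= t ^+ 2 * dot x x.
Proof.
move=> [[linP _] P0] Pt t0; set n := dot (P x) (P x).
have herm a b : dot (P b) a = (dot (P a) b)^*.
  by apply: quadratic_real_hermitian => // z; apply/ger0_real/P0.
have n0 : 0 <= n by exact: dnorm_ge0.
have key (s : R[i]) : s \is Num.real ->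
    0 <= dot (P x) x - 2 * s * n + s ^+ 2 * (t * n).
  move=> sr; apply: le_trans (P0 (x - s *: P x)) _.
  rewrite linear_funB// linear_funZ// !linearBl !linearBr /=.
  rewrite !(linearZl_LR dot) !(linearZr_LR dot) /= (CrealP sr).
  rewrite (herm x (P x)) -/n (CrealP (ger0_real n0)).
  rewrite (_ : _ - _ =
    dot (P x) x - 2 * s * n + s ^+ 2 * dot (P (P x)) (P x)); last by ring.
  by rewrite lerD2l ler_wpM2l// real_exprn_even_ge0.
have [t00|tn0] := eqVneq t 0.
  have := key 1 (rpred1 _); rewrite t00 mul0r mulr0 addr0 mulr1.
  have -> : dot (P x) x = 0.
    by apply/eqP; rewrite eq_le P0 andbT (le_trans (Pt x))// t00 mul0r.
  by rewrite sub0r oppr_ge0 pmulr_rle0// expr0n mul0r.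
have tp : 0 < t by rewrite lt_def tn0.
have := key t^-1; rewrite realV ger0_real// => /(_ isT).
have -> : t^-1 ^+ 2 * (t * n) = t^-1 * n by field.
have -> : dot (P x) x - 2 * t^-1 * n + t^-1 * n =
  dot (P x) x - t^-1 * n by ring.
rewrite subr_ge0 => /le_trans/(_ (Pt x)).
by rewrite ler_pdivrMl// mulrA -expr2.
Qed.

(** Complex scalars are essential here. With [y = T x], the cross term at [x, y] gives
    [<T y, x> = - <y, y>], and the one at [x, 'i *: y] then equals [- 2 'i <y, y>], so that
    [<y, y> = 0]. *)
Lemma linear_quadratic_eq0 T : linear T ->
  (forall x, dot (T x) x = 0) -> forall x, T x = 0.
Proof.
move=> linT T0.
have sum0 x y : dot (T x) y + dot (T y) x = 0.
  have := T0 (x + y); rewrite linear_funD// linearDl !linearDr /= !T0.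
  by rewrite add0r addr0.
move=> x; apply/eqP; rewrite -(dnorm_eq0 dot); set y := T x.
have := sum0 x ('i *: y); rewrite linear_funZ// linearZl_LR linearZr_LR /=.
have -> : dot (T y) x = - dot y y by apply/eqP; rewrite -addr_eq0 addrC sum0.
rewrite -/y conjCi mulrN mulNr => /eqP.
by rewrite -opprD oppr_eq0 -mulr2n mulrn_eq0 /= mulf_eq0 (negPf (neq0Ci _)).
Qed.

End QuadraticForms.

(** * Orthonormal bases and the trace norm *)

Section TraceNorm.
Context {R : realType} {H : completeNormedModType R[i]}.
Variable dot : {dot H for conjC}.
Hypothesis dot_norm : forall x : H, `|x| ^+ 2 = dot x x.
Implicit Types (T P : H -> H) (x y : H).

Definition orthonormal_set (A : set H) : Prop :=
  (forall e, A e -> dot e e = 1) /\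
  (forall e e', A e -> A e' -> e != e' -> dot e e' = 0).

Lemma unit_vector_scale x : x != 0 -> dot (`|x|^-1 *: x) (`|x|^-1 *: x) = 1.
Proof.
move=> x0; rewrite dnormZ normfV normr_id -dot_norm exprVn mulVf//.
by rewrite expf_neq0// normr_eq0.
Qed.

(** Zorn's lemma, applied to the sets whose union with [A0] is orthonormal; joining [A0] makes the
    empty chain harmless. A nonzero vector orthogonal to a maximal such union could be normalized
    and adjoined. *)
Lemma orthonormal_basis_ext A0 : orthonormal_set A0 ->
  exists2 B, orthonormal_basis dot B & A0 `<=` B.
Proof.
move=> oA0.
have [F FP Ftot|A [[oA1 oA2] maxA]] :=
    @Zorn_bigcup H [set A | orthonormal_set (A0 `|` A)].
  have pair X a b : F X -> (A0 `|` X) a -> (A0 `|` X) b -> a != b ->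
      dot a b = 0 by move=> /FP[_]; apply.
  split=> [a [/oA0.1//|[X FX Xa]]|a b].
    by have [+ _] := FP _ FX; apply; right.
  move=> [a0|[X FX Xa]] [b0|[Y FY Yb]].
  - exact: oA0.2.
  - by apply: (pair Y) => //; [left|right].
  - by apply: (pair X) => //; [right|left].
  - have [XY|YX] := Ftot _ _ FX FY.
    + by apply: (pair Y) => //; right => //; exact: XY.
    + by apply: (pair X) => //; right => //; exact: YX.
exists (A0 `|` A); last by move=> a; left.
split=> // x xA; apply/eqP/negP => /negP x0.
pose u := `|x|^-1 *: x.
have uA a : (A0 `|` A) a -> dot u a = 0.
  by move=> Aa; rewrite linearZl_LR /= xA// mulr0.
have uu : dot u u = 1 by exact: unit_vector_scale.
have Nu : ~ (A0 `|` A) u by move=> /uA; rewrite uu; exact/eqP/oner_neq0.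
apply: (maxA (u |` A)).
  by split=> [a Aa|AuA]; [right|apply: Nu; right; apply: AuA; left].
have cases c : (A0 `|` (u |` A)) c -> c = u \/ (A0 `|` A) c.
  by move=> [?|[->|?]]; [right; left|left|right; right].
split=> [a /cases[->//|Aa]|a b]; first exact: oA1.
move=> /cases[->|Aa] /cases[->|Ab] ab; first by rewrite eqxx in ab.
- exact: uA.
- by rewrite (dotC dot u a) uA// conjC0.
- exact: oA2.
Qed.

(** Any unit vector extends to an orthonormal basis, and a single diagonal entry is at most the sum
    of all of them. For [0 <= t] it is enough that some basis exists, namely one extending the empty
    set. *)
Lemma positive_trace_bound P (t : R) : positive_operator dot P ->
  positive_trace dot P t%:E ->
  0 <= t /\ forall x, dot (P x) x <= t%:C * dot x x.
Proof.
move=> Ppos Pt; have [[linP _] P0] := Ppos.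
have Re_ge0 y : 0 <= complex.Re (dot (P y) y).
  by have := P0 y; rewrite lecE => /andP[].
split.
  have [|B oB _] := @orthonormal_basis_ext set0; first by split.
  by rewrite -lee_fin -(Pt B oB) esum_ge0// => e _; rewrite lee_fin.
move=> x; have [->|x0] := eqVneq x 0.
  have d0 y : dot y 0 = 0 by exact: linear0r.
  by rewrite !d0 mulr0.
have [u xE uu] : exists2 u, x = `|x| *: u & dot u u = 1.
  exists (`|x|^-1 *: x); last exact: unit_vector_scale.
  by rewrite scalerA mulfV ?normr_eq0// scale1r.
have ut : complex.Re (dot (P u) u) <= t.
  have [|B oB Bu] := @orthonormal_basis_ext [set u].
    by split=> [_ ->|_ _ -> ->] //; rewrite eqxx.
  rewrite -lee_fin -(Pt B oB); apply: esum_ge; exists [set u].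
    by split=> // _ ->; apply: Bu.
  by rewrite fsbig_set1.
rewrite xE (linear_funZ linP) !(linearZl_LR dot) !(linearZr_LR dot) /= uu mulr1.
rewrite (CrealP (normr_real x)) mulrA [leRHS]mulrC ler_wpM2l ?mulr_ge0//.
have /RRe_real <- : dot (P u) u \is Num.real by exact/ger0_real/P0.
by rewrite lecR.
Qed.

(** Cauchy-Schwarz for [T x] and [x], where [T x] has the same norm as [P x] for [P = |T|], and the
    trace of [P] bounds [P]. *)
Lemma trace_norm_quadratic_bound T (t : R) x : trace_norm dot T t ->
  `|dot (T x) x| <= t%:C * dot x x.
Proof.
move=> [_ [P [Ppos PT] /(positive_trace_bound Ppos)[t0 Pt]]].
have tC : 0 <= t%:C :> R[i] by rewrite ler0c.
rewrite -(@ler_pXn2r _ 2)// ?nnegrE ?mulr_ge0 ?dnorm_ge0//.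
apply: le_trans (dot_CauchySchwarz _ _ _) _.
rewrite exprMn [X in _ <= _ * X]expr2 mulrA ler_wpM2r ?dnorm_ge0// -PT.
exact: positive_operator_norm_bound.
Qed.

(** This makes quadratic forms admissible test functionals for the Pettis integral. *)
Lemma trace_class_dual_quadratic x :
  trace_class_dual dot (fun T => dot (T x) x).
Proof.
split=> [c S T _ _|].
  rewrite -[RHS]/(c * dot (S x) x + dot (T x) x) -(linearZl_LR dot).
  by rewrite -linearDl.
exists (complex.Re (dot x x)) => T t /(@trace_norm_quadratic_bound T t x).
have /RRe_real {1}<- : dot x x \is Num.real by exact/ger0_real/dnorm_ge0.
by rewrite -rmorphM mulrC.
Qed.

(** Distinct basis vectors satisfy [|e - e'| ^+ 2 = 2], so two of them cannot both be within 1/2 of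
    the same point; choosing a nearby point of the countable dense set is therefore injective. *)
Lemma orthonormal_basis_countable B : separable_space H ->
  orthonormal_basis dot B -> countable B.
Proof.
move=> [A cA dA] [B1 B2 _].
have near (e : H) : exists2 a, A a & `|e - a| < 2^-1.
  have [|a [ea Aa]] := dA (ball e (2^-1 : R[i])) _ (ball_open _ _).
    by exists e; apply: ballxx; rewrite invr_gt0.
  by exists a => //; rewrite -ball_normE in ea.
have /choice[g Ag] : forall e : H, exists a, A a /\ `|e - a| < 2^-1.
  by move=> e; have [a] := near e; exists a.
have /countable_injP[k kinj] := cA.
apply/countable_injP; exists (k \o g) => e e' /[!inE] Be Be' /= /kinj.
rewrite !inE => /(_ (Ag e).1 (Ag e').1) gee'.
apply/eqP/negP => /negP ee'.
have : `|e - e'| < 1.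
  rewrite -(subrKA (g e)) {2}gee' [1]splitr mul1r.
  by rewrite (le_lt_trans (ler_normD _ _))// ltrD ?(Ag e).2// distrC (Ag e').2.
move=> /ltW h.
have : `|e - e'| ^+ 2 <= 1 by rewrite exprn_ile1.
rewrite dot_norm (hnormBd (B2 _ _ Be Be' ee')) /= !B1//.
by rewrite gerDl ler10.
Qed.
End TraceNorm.

(** * Pettis integrals seen through their quadratic forms *)

Section PettisIntegral.
Context {R : realType} {H : completeNormedModType R[i]}.
Variable dot : {dot H for conjC}.
Hypothesis dot_norm : forall x : H, `|x| ^+ 2 = dot x x.
Implicit Types (S T P : H -> H) (x y : H).

(** Real-valued, so as to be integrated as an extended real function; for positive [T] the real part
    loses nothing. *)
Definition quad T x : R := complex.Re (dot (T x) x).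

Lemma quad_ge0 T x : positive_operator dot T -> 0 <= quad T x.
Proof. by move=> [_ /(_ x)]; rewrite lecE => /andP[]. Qed.

Lemma positive_quadE T x :
  positive_operator dot T -> dot (T x) x = (quad T x)%:C.
Proof. by move=> [_ T0]; rewrite RRe_real// ger0_real. Qed.

Lemma bounded_operator_lincomb (p q : R) S T :
  bounded_operator S -> bounded_operator T ->
  bounded_operator (p%:C *: S + q%:C *: T).
Proof.
move=> [linS contS] [linT contT]; split.
  move=> a u v.
  change (p%:C *: S (a *: u + v) + q%:C *: T (a *: u + v) =
    a *: (p%:C *: S u + q%:C *: T u) + (p%:C *: S v + q%:C *: T v)).
  rewrite linS linT !scalerDr !scalerA ![_ * a]mulrC -!addrA; congr (_ + _).
  by rewrite !addrA; congr (_ + _); rewrite addrC.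
move=> x; apply: (@cvgD _ _ _ _ _ _ _ (p%:C *: S x) (q%:C *: T x)).
  by apply: cvgZr; exact: contS.
by apply: cvgZr; exact: contT.
Qed.

Lemma dot_lincomb (p q : R) S T x :
  dot ((p%:C *: S + q%:C *: T) x) x = p%:C * dot (S x) x + q%:C * dot (T x) x.
Proof.
rewrite -[(_ + _) x]/(p%:C *: S x + q%:C *: T x) linearDl.
by rewrite !(linearZl_LR dot).
Qed.

Lemma positive_operator_lincomb (p q : R) S T : 0 <= p -> 0 <= q ->
  positive_operator dot S -> positive_operator dot T ->
  positive_operator dot (p%:C *: S + q%:C *: T).
Proof.
move=> p0 q0 [bS S0] [bT T0]; split; first exact: bounded_operator_lincomb.
by move=> x; rewrite dot_lincomb addr_ge0// mulr_ge0// ler0c.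
Qed.

Lemma quad_lincomb (p q : R) S T x :
  positive_operator dot S -> positive_operator dot T ->
  quad (p%:C *: S + q%:C *: T) x = p * quad S x + q * quad T x.
Proof.
move=> Sp Tp; rewrite /quad dot_lincomb !positive_quadE//.
by rewrite -!rmorphM -rmorphD.
Qed.

Lemma ge0_quad_positive T :
  bounded_operator T -> (forall x, complex.Im (dot (T x) x) = 0) ->
  (forall x, 0 <= quad T x) -> positive_operator dot T.
Proof.
by move=> bT imT qT; split=> // x; rewrite lecE/= imT eqxx; exact: qT.
Qed.

Lemma positive_ext S T : positive_operator dot S -> positive_operator dot T ->
  quad S =1 quad T -> S = T.
Proof.
move=> Sp Tp ST; have [[linS _] _] := Sp; have [[linT _] _] := Tp.
apply/funext => x; apply/eqP; rewrite -subr_eq0; apply/eqP.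
have linD : linear (fun x => S x - T x).
  move=> a u v; rewrite linS linT scalerBr opprD !addrA; congr (_ + _).
  by rewrite -!addrA; congr (_ + _); rewrite addrC.
apply: (linear_quadratic_eq0 (dot := dot) linD) => y.
by rewrite linearBl /= !positive_quadE// ST subrr.
Qed.

Lemma operator_leP (c : R) S T :
  positive_operator dot S -> positive_operator dot T ->
  (forall x, c * quad S x <= quad T x) -> operator_le dot (c%:C *: S) T.
Proof.
move=> Sp Tp ST; have [[bS S0] [bT T0]] := (Sp, Tp).
rewrite /operator_le.
have -> : T - c%:C *: S = 1%:C *: T + (- c)%:C *: S.
  by rewrite scale1r rmorphN /= scaleNr.
split; first exact: bounded_operator_lincomb.
move=> x; rewrite dot_lincomb !positive_quadE// -!rmorphM -rmorphD /= ler0c.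
by rewrite mul1r mulNr subr_ge0.
Qed.

Section StateValued.
Context {d : measure_display} {X : measurableType d}.
Variable w : X -> (H -> H).
Hypothesis w_state : forall s, state dot (w s).

Lemma pettis_integral_quad (mu : probability X R) T x :
  pettis_integral dot mu setT w T ->
  [/\ mu.-integrable setT (fun s => (quad (w s) x)%:E),
     complex.Im (dot (T x) x) = 0 &
     (quad T x)%:E = (\int[mu]_s (quad (w s) x)%:E)%E].
Proof.
move=> [_ /(_ _ (trace_class_dual_quadratic dot_norm x))[[intRe intIm] TE]].
have wp s : positive_operator dot (w s) by case: (w_state s).
split=> //.
  (* The forms of the states [w s] are real, so the imaginary part is the integral of zero. *)
  rewrite TE /= /Rintegral (eq_integral (cst 0%E)) ?integral0// => s _ /=.
  by rewrite positive_quadE.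
by rewrite /quad TE /= /Rintegral fineK// integrable_fin_num.
Qed.

(* The trace is recovered from the quadratic forms by Tonelli's theorem, an
   orthonormal basis being countable by separability. *)
Lemma pettis_integral_state (mu : probability X R) T : separable_space H ->
  pettis_integral dot mu setT w T -> state dot T.
Proof.
move=> H_sep TI; have [Ttc _] := TI.
have bT : bounded_operator T by have [t []] := Ttc.
have wp s : positive_operator dot (w s) by case: (w_state s).
have Tp : positive_operator dot T.
  apply: ge0_quad_positive => // x;
    have [_ ImT QT] := pettis_integral_quad x TI; first exact: ImT.
  by rewrite -lee_fin QT integral_ge0// => s _; rewrite lee_fin quad_ge0.
split=> // B oB.
have /countable_injP[k kinj] := orthonormal_basis_countable dot_norm H_sep oB.
(* Over an empty basis the traces of [T] and of [w point] are the same empty sum, and the latter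
   trace is 1. *)
have [B0|/set0P[e0 Be0]] := eqVneq B set0.
  have [_ _ /(_ B oB)] := w_state point.
  by rewrite B0 !esum_set0.
(* [g] inverts the numbering [k] of the basis; its default value [e0] is never counted, since the
   series below is zero off the image of [k]. *)
pose g := 'pinv_(fun=> e0) B k.
have sumB (F : H -> \bar R) : (forall e, 0 <= F e)%E ->
    \esum_(e in B) F e =
      (\sum_(n <oo) (if n \in k @` B then F (g n) else 0))%E.
  move=> F0; rewrite nneseries_esumT; last by move=> n; case: ifP.
  rewrite -esum_mkcond esum_image; last first.
    by move=> a b; exact: kinj.
  by apply: eq_esum => e Be; rewrite /g pinvKV ?inE.
rewrite sumB; last by move=> e; rewrite lee_fin quad_ge0.
transitivity (\int[mu]_s 1)%E; last first.
  by rewrite integral_cst// mul1e; exact: probability_setT.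
transitivity (\int[mu]_s (\sum_(n <oo)
    (if n \in k @` B then (quad (w s) (g n))%:E else 0)))%E.
  rewrite integral_nneseries//.
  - apply: eq_eseriesr => n _; case: ifPn => _; last by rewrite integral0.
    by have [] := pettis_integral_quad (g n) TI.
  - move=> n; case: (n \in _); last exact: measurable_cst.
    by have [/(measurable_int mu)] := pettis_integral_quad (g n) TI.
  - by move=> n s _; case: ifPn => // _; rewrite lee_fin quad_ge0.
apply: eq_integral => s _.
rewrite -(sumB (fun e => (quad (w s) e)%:E)); last first.
  by move=> e; rewrite lee_fin quad_ge0.
by have [_ _ ->] := w_state s.
Qed.

Hypothesis H_sep : separable_space H.
Hypothesis w_pettis : forall mu : probability X R, pettis_integrable dot mu w.

(* [P] is only the default value required by [mnormalize]. *)
Lemma finite_measure_barycenter (P : probability X R)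
    (m : {measure set X -> \bar R}) (c : R) :
  0 < c -> m setT = c%:E ->
  exists2 T, quasi_classical dot w T &
    forall x, ((c * quad T x)%:E = \int[m]_s (quad (w s) x)%:E)%E.
Proof.
move=> c0 mc; pose mu : probability X R := mnormalize m P.
have wp s : positive_operator dot (w s) by case: (w_state s).
have [T TI] := w_pettis mu measurableT.
have Tst := pettis_integral_state H_sep TI.
exists T; first by split=> //; exists mu.
move=> x; have [/(measurable_int mu) mw _ TE] := pettis_integral_quad x TI.
rewrite EFinM TE.
(* The factor [c] moves into the measure, and [c] times the normalization of [m] is [m] again. *)
rewrite -(@ge0_integral_mscale _ _ _ _ _ measurableT (NngNum (ltW c0)))//;
  last by move=> s _; rewrite lee_fin quad_ge0.
apply: eq_measure_integral => A mA _.
change (c%:E * mnormalize m P A = m A)%E.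
rewrite /mnormalize mc eqe (gt_eqF c0) /=.
by rewrite muleCA -EFinM mulfV ?gt_eqF// mule1.
Qed.

End StateValued.
End PettisIntegral.

(** * Hahn-Jordan decomposition and total variation *)

Section TotalVariation.
Context {R : realType} {d : measure_display} {X : measurableType d}.
Local Open Scope ereal_scope.

(** [jp] and [jn] are the Jordan parts of [mu - nu], and [m] is the minimum of [mu] and [nu]: it is
    [mu] on the negative set [N] and [nu] on the positive set [P]. Since both measures have mass 1,
    the Jordan parts have equal mass [e = mu P - nu P]. *)
Lemma probability_overlap (mu nu : probability X R) :
  exists (m jp jn : {measure set X -> \bar R}),
  [/\ forall A, measurable A -> mu A = m A + jp A,
      forall A, measurable A -> nu A = m A + jn A,
      jp setT = (TV mu nu)%:E & jn setT = (TV mu nu)%:E].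
Proof.
pose la := cadd (charge_of_finite_measure mu)
  (copp (charge_of_finite_measure nu)).
have [P [N PN]] := Hahn_decomposition la.
have [[mP posP] [mN negN] PNT PN0] := PN.
have jpE A : measurable A -> jordan_pos PN A = mu (A `&` P) - nu (A `&` P).
  by move=> mA; rewrite jordan_posE cjordan_posE /crestr0 mem_set.
have jnE A : measurable A -> jordan_neg PN A = nu (A `&` N) - mu (A `&` N).
  move=> mA; rewrite jordan_negE cjordan_negE /crestr0 mem_set//.
  change (- (mu (A `&` N) - nu (A `&` N)) = nu (A `&` N) - mu (A `&` N)).
  rewrite fin_num_oppeB 1?addeC//; apply: fin_num_measure; exact: measurableI.
have split_PN (p : probability X R) A : measurable A ->
    p A = p (A `&` P) + p (A `&` N).
  move=> mA; rewrite -measureU ?setIUr//;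
    [|exact: measurableI|exact: measurableI|].
    by rewrite -setIUr PNT setIT.
  by rewrite setIACA PN0 setI0.
have fin (p : probability X R) A : measurable A -> p A = (fine (p A))%:E.
  by move=> mA; rewrite fineK// fin_num_measure.
pose m : {measure set X -> \bar R} := measure_add (mrestr mu mN) (mrestr nu mP).
have mE A : m A = mu (A `&` N) + nu (A `&` P) by exact: measure_addE.
have mAP A : measurable A -> measurable (A `&` P).
  by move=> ?; exact: measurableI.
have mAN A : measurable A -> measurable (A `&` N).
  by move=> ?; exact: measurableI.
pose e : R := (fine (mu P) - fine (nu P))%R.
have jpT : jordan_pos PN setT = e%:E.
  by rewrite jpE// setTI (fin mu P mP) (fin nu P mP).
have jnT : jordan_neg PN setT = e%:E.
  rewrite jnE// setTI.
  have := split_PN mu _ measurableT; have := split_PN nu _ measurableT.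
  rewrite !setTI ![_ setT]probability_setT (fin mu P mP) (fin nu P mP).
  rewrite (fin mu N mN) (fin nu N mN) -!EFinD => -[nuT] [muT].
  by congr EFin; rewrite /e; lra.
have TVe : TV mu nu = e.
  (* [mu A - nu A] is a difference of the Jordan parts at [A], both lying between 0 and [e]. The
     bound is attained at [A = P]. *)
  have D_le A : measurable A -> (`|fine (mu A) - fine (nu A)| <= e)%R.
    move=> mA.
    have jpA : jordan_pos PN A <= e%:E by rewrite -jpT le_measure ?inE.
    have jnA : jordan_neg PN A <= e%:E by rewrite -jnT le_measure ?inE.
    have jpA0 : 0 <= jordan_pos PN A by exact: measure_ge0.
    have jnA0 : 0 <= jordan_neg PN A by exact: measure_ge0.
    move: jpA jnA jpA0 jnA0.
    rewrite jpE// jnE// (split_PN mu A)// (split_PN nu A)//.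
    rewrite (fin mu _ (mAP _ mA)) (fin nu _ (mAP _ mA)).
    rewrite (fin mu _ (mAN _ mA)) (fin nu _ (mAN _ mA)) -!EFinD !lee_fin /=.
    by move=> *; rewrite ler_norml; lra.
  apply/eqP; rewrite eq_le; apply/andP; split.
    apply: ge_sup; first by exists `|fine (mu P) - fine (nu P)|%R; exists P.
    by move=> _ [A mA <-]; exact: D_le.
  apply: le_trans (ler_norm _) _; apply: ub_le_sup; last by exists P.
  by exists e => _ [A mA <-]; exact: D_le.
have muE A : measurable A -> mu A = m A + jordan_pos PN A.
  move=> mA; rewrite mE jpE// (split_PN mu A)//.
  rewrite (fin mu _ (mAP _ mA)) (fin nu _ (mAP _ mA)) (fin mu _ (mAN _ mA)).
  by rewrite -!EFinD; congr EFin; ring.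
have nuE A : measurable A -> nu A = m A + jordan_neg PN A.
  move=> mA; rewrite mE jnE// (split_PN nu A)//.
  rewrite (fin nu _ (mAP _ mA)) (fin nu _ (mAN _ mA)) (fin mu _ (mAN _ mA)).
  by rewrite -!EFinD; congr EFin; ring.
by exists m, (jordan_pos PN), (jordan_neg PN); rewrite TVe.
Qed.
End TotalVariation.

(** * Splitting a component off a quasi-classical state *)

Section QuasiClassical.
Context {R : realType} {H : completeNormedModType R[i]}.
Variable dot : {dot H for conjC}.
Hypothesis dot_norm : forall x : H, `|x| ^+ 2 = dot x x.
Hypothesis H_sep : separable_space H.
Context {d : measure_display} {X : measurableType d}.
Variable w : X -> (H -> H).
Hypothesis w_state : forall s, state dot (w s).
Hypothesis w_pettis : forall mu : probability X R, pettis_integrable dot mu w.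
Local Notation Q := (quasi_classical dot w).

(* The state [rest] exhibits [tau] as a component of [rho] with weight
   eps / 2 < 1, which forces f tau < +oo as soon as f rho < +oo; with weight
   eps the complement would degenerate when eps = 1. *)
Lemma quasi_classical_component (mu : probability X R)
    (m j : {measure set X -> \bar R}) (eps : R) (rho : H -> H) :
  representing_measure dot w rho mu ->
  (forall A, measurable A -> mu A = m A + j A)%E ->
  j setT = eps%:E -> 0 < eps ->
  exists tau rest, [/\ Q tau, Q rest,
    [/\ eps <= 1, operator_le dot (eps%:C *: tau) rho &
        operator_le dot ((1 - eps / 2)%:C *: rest) rho],
    rho = (eps / 2)%:C *: tau + (1 - eps / 2)%:C *: rest &
    forall x, (quad dot rho x - eps * quad dot tau x)%:E =
      (\int[m]_s (quad dot (w s) x)%:E)%E].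
Proof.
move=> rhoI muE jT eps0.
have wp s : positive_operator dot (w s) by case: (w_state s).
have mT : m setT = (1 - eps)%:E.
  have := muE _ measurableT; rewrite [_ setT]probability_setT jT => mu1.
  by rewrite EFinB mu1 addeK.
have eps1 : eps <= 1 by rewrite -subr_ge0 -lee_fin -mT measure_ge0.
have [tau Qtau tauE] :=
  finite_measure_barycenter dot_norm w_state H_sep w_pettis mu eps0 jT.
have half0 : 0 <= 2^-1 :> R by rewrite invr_ge0.
(* What remains of [mu] once half of [j] is removed; [rest] is its normalized barycenter. *)
pose m' : {measure set X -> \bar R} := measure_add m (mscale (NngNum half0) j).
have rest0 : 0 < 1 - eps / 2 by lra.
have m'T : m' setT = (1 - eps / 2)%:E.
  rewrite [LHS]measure_addE mT.
  change ((1 - eps)%:E + 2^-1%:E * j setT = (1 - eps / 2)%:E)%E.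
  by rewrite jT -EFinM -EFinD; congr EFin; lra.
have [rest Qrest restE] :=
  finite_measure_barycenter dot_norm w_state H_sep w_pettis mu rest0 m'T.
have rhop : positive_operator dot rho.
  by case: (pettis_integral_state dot_norm w_state H_sep rhoI).
have taup : positive_operator dot tau by case: Qtau => -[].
have restp : positive_operator dot rest by case: Qrest => -[].
have mw x := let: And3 intw _ _ := pettis_integral_quad dot_norm w_state x rhoI
  in measurable_int mu intw.
have wq0 x s : setT s -> (0 <= (quad dot (w s) x)%:E)%E.
  by move=> _; rewrite lee_fin quad_ge0.
(* [rho - eps tau] is the integral of [w] against [m]. This yields its positivity here, and later
   the identification of the remainders of [rho] and [sigma], which share [m]. *)
have intm x : (quad dot rho x - eps * quad dot tau x)%:E =
    (\int[m]_s (quad dot (w s) x)%:E)%E.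
  have [_ _ rhoE] := pettis_integral_quad dot_norm w_state x rhoI.
  rewrite EFinB rhoE.
  rewrite (eq_measure_integral (m1 := mu) (measure_add m j)); last first.
    by move=> A mA _; apply: (etrans (muE _ mA)); exact/esym/measure_addE.
  by rewrite ge0_integral_measure_add//; [rewrite -tauE addeK|exact: wq0].
have restq x : (1 - eps / 2) * quad dot rest x =
    quad dot rho x - eps / 2 * quad dot tau x.
  apply: EFin_inj; rewrite restE ge0_integral_measure_add//; last exact: wq0.
  rewrite ge0_integral_mscale//; last exact: wq0.
  by rewrite -[X in (_ * X)%E]tauE -intm -EFinM -EFinD /=; congr EFin; field.
have intm0 x : 0 <= quad dot rho x - eps * quad dot tau x.
  by rewrite -lee_fin intm integral_ge0// => s; exact: wq0.
exists tau, rest; split=> //.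
- split=> //; apply: operator_leP => // x; first by rewrite -subr_ge0.
  rewrite restq lerBlDr lerDl mulr_ge0 ?quad_ge0//.
  by rewrite divr_ge0// ltW.
- have p0 : 0 <= eps / 2 by rewrite divr_ge0// ltW.
  apply: (positive_ext rhop) => [|x].
    by apply: positive_operator_lincomb => //; exact: ltW.
  by rewrite quad_lincomb// restq; ring.
Qed.

End QuasiClassical.

(** * Representing measures at total variation distance zero *)

Section ZeroDistance.
Context {R : realType}.

(** For [eps = 0] the term [D_term] involves the values of [a] and [b] at 0, whereas only their
    right limits there are given as zero. *)
Lemma within_cont_eq0 (g : R -> R) : {within `[0, 1], continuous g} ->
  g p @[p --> 0^'+] --> (0 : R) -> g 0 = 0.
Proof.
move=> /(continuous_within_itvP _ ltr01)[_ g0 _] glim.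
exact: (cvg_unique _ g0 glim).
Qed.

Context {H : completeNormedModType R[i]}.
Variable dot : {dot H for conjC}.
Hypothesis dot_norm : forall x : H, `|x| ^+ 2 = dot x x.
Hypothesis H_sep : separable_space H.
Context {d : measure_display} {X : measurableType d}.
Variable w : X -> (H -> H).
Hypothesis w_state : forall s, state dot (w s).

(** Both Jordan parts have mass zero, so both measures agree with the common part [m], and the two
    states have equal quadratic forms. *)
Lemma TV_eq0_representing (mu nu : probability X R) (rho sigma : H -> H) :
  representing_measure dot w rho mu -> representing_measure dot w sigma nu ->
  TV mu nu = 0 -> rho = sigma.
Proof.
move=> rhoI sigmaI tv0.
have [m [jp [jn [muE nuE jpT jnT]]]] := probability_overlap mu nu.
have [rhop _ _] := pettis_integral_state dot_norm w_state H_sep rhoI.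
have [sigmap _ _] := pettis_integral_state dot_norm w_state H_sep sigmaI.
have null (j : {measure set X -> \bar R}) A :
    j setT = 0%:E -> measurable A -> j A = 0%E.
  move=> j0 mA; apply/eqP; rewrite eq_le measure_ge0 andbT.
  by rewrite -[leRHS]/0%:E -j0 le_measure ?inE.
apply: (positive_ext rhop sigmap) => x; apply: EFin_inj.
have [_ _ ->] := pettis_integral_quad dot_norm w_state x rhoI.
have [_ _ ->] := pettis_integral_quad dot_norm w_state x sigmaI.
apply: eq_measure_integral => A mA _.
apply: (etrans (muE _ mA)); apply: (etrans _ (esym (nuE _ mA))).
by rewrite (null jp _ _ mA) ?(null jn _ _ mA) ?jpT ?jnT ?tv0.
Qed.

End ZeroDistance.

(** * The bound on [f rho - f sigma] from two equal mixtures *)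

Theorem lemma1 (R : realType) (H : completeNormedModType R[i])
  (dot : {dot H for conjC})
  (dot_norm : forall x : H, `|x| ^+ 2 = dot x x)
  (H_separable : separable_space H)
  (d : measure_display) (X : measurableType d)
  (w : X -> (H -> H))
  (w_meas : state_valued_measurable dot w)
  (w_pettis : forall mu : probability X R, pettis_integrable dot mu w)
  (S0 : set (H -> H))
  (S0_state : S0 `<=` state dot)
  (S0_convex : forall (rho sigma : H -> H) (p : R),
     S0 rho -> S0 sigma -> 0 <= p <= 1 ->
     S0 (p%:C *: rho + (1 - p)%:C *: sigma))
  (S0_hereditary : forall rho, (S0 `&` quasi_classical dot w) rho ->
     [set sigma | quasi_classical dot w sigma /\
        exists2 eps : R, 0 < eps & operator_le dot (eps%:C *: sigma) rho]
       `<=` S0)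
  (f : (H -> H) -> \bar R)
  (f_proper : forall rho, S0 rho -> (-oo < f rho)%E)
  (a b : R -> R)
  (a_cont : {within `[0, 1], continuous a})
  (b_cont : {within `[0, 1], continuous b})
  (a_lim : a p @[p --> 0^'+] --> (0 : R))
  (b_lim : b p @[p --> 0^'+] --> (0 : R))
  (f_concave : forall rho sigma (p : R), S0 rho -> S0 sigma -> 0 <= p <= 1 ->
     (p%:E * f rho + (1 - p)%:E * f sigma - (a p)%:E
        <= f (p%:C *: rho + (1 - p)%:C *: sigma)%R)%E)
  (f_convex : forall rho sigma (p : R), S0 rho -> S0 sigma -> 0 <= p <= 1 ->
     (f (p%:C *: rho + (1 - p)%:C *: sigma)%R
        <= p%:E * f rho + (1 - p)%:E * f sigma + (b p)%:E)%E)
  (rho sigma : H -> H)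
  (rho_mem : (quasi_classical dot w `&` S0) rho)
  (sigma_mem : (quasi_classical dot w `&` S0) sigma)
  (mu_rho mu_sigma : probability X R)
  (mu_rhoP : representing_measure dot w rho mu_rho)
  (mu_sigmaP : representing_measure dot w sigma mu_sigma)
  (f_rho_fin : (f rho < +oo)%E) :
  let eps := TV mu_rho mu_sigma in
  let Q := quasi_classical dot w in
  (f rho - f sigma
     <= eps%:E * C_sup dot Q f rho sigma eps + (D_term a b eps)%:E)%E /\
  ((forall tau, S0 tau -> (0 <= f tau)%E) ->
   (f rho - f sigma
      <= eps%:E * C_sup_plus dot Q f rho eps + (D_term a b eps)%:E)%E).
Proof.
have w_state s : state dot (w s) by case: w_meas.
have [Qrho S0rho] := rho_mem; have [Qsigma S0sigma] := sigma_mem.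
have [fr frE] : exists fr, f rho = fr%:E.
  exists (fine (f rho)); rewrite fineK// fin_numE (gt_eqF (f_proper _ S0rho)).
  by rewrite (lt_eqF f_rho_fin).
have [m [jp [jn [muE nuE jpT jnT]]]] := probability_overlap mu_rho mu_sigma.
move=> eps Q; rewrite -/eps in jpT jnT.
(* For [eps = 0] both sides vanish: the product with the supremum is zero even if the supremum is
   infinite. *)
have [eps0|eps_neq0] := eqVneq eps 0.
  have <- : rho = sigma by exact: TV_eq0_representing eps0.
  have a0 := within_cont_eq0 a_cont a_lim.
  have b0 := within_cont_eq0 b_cont b_lim.
  rewrite eps0 /D_term mul0r a0 b0 !addr0 mulr0 !mul0e adde0 subee//.
  by rewrite frE.
have eps_gt0 : 0 < eps.
  by rewrite lt_def eps_neq0 -lee_fin -jpT measure_ge0.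
have [tp [rp [Qtp Qrp [eps1 tp_le rp_le] rhoE rhoq]]] :=
  quasi_classical_component dot_norm H_separable w_state w_pettis mu_rhoP muE
    jpT eps_gt0.
have [tn [rn [Qtn Qrn [_ tn_le rn_le] sigmaE sigmaq]]] :=
  quasi_classical_component dot_norm H_separable w_state w_pettis mu_sigmaP nuE
    jnT eps_gt0.
have rest0 : 0 < 1 - eps / 2 by lra.
have S0tp : S0 tp by apply: (S0_hereditary rho) => //; split=> //; exists eps.
have S0tn : S0 tn by apply: (S0_hereditary sigma) => //; split=> //; exists eps.
have S0rp : S0 rp.
  by apply: (S0_hereditary rho) => //; split=> //; exists (1 - eps / 2).
have S0rn : S0 rn.
  by apply: (S0_hereditary sigma) => //; split=> //; exists (1 - eps / 2).
(* If [f tau] were [+oo], the lower bound on [f] at the mixture would be [+oo]: [f rest > -oo]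
   excludes any cancellation. This would contradict [f om < +oo]. *)
have component_fin om tau rest : S0 tau -> S0 rest ->
    om = (eps / 2)%:C *: tau + (1 - eps / 2)%:C *: rest ->
    (f om < +oo)%E -> exists r : R, f tau = r%:E.
  move=> S0tau S0rest omE om_fin.
  have half : 0 <= eps / 2 <= 1 by lra.
  have := f_concave tau rest _ S0tau S0rest half; rewrite -omE.
  have := f_proper tau S0tau; have := f_proper rest S0rest.
  case: (f tau) => [r _ _ _|restN _|//]; first by exists r.
  rewrite gt0_muley ?lte_fin; last by lra.
  rewrite addye; last first.
    case: (f rest) restN => [s _|_|//]; first by rewrite -EFinM.
    by rewrite gt0_muley ?lte_fin.
  by rewrite addye// leye_eq => /eqP omy; rewrite omy in om_fin.
have [ftp ftpE] := component_fin _ _ _ S0tp S0rp rhoE f_rho_fin.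
have [fsy|fs_neqy] := eqVneq (f sigma) +oo%E.
  by rewrite fsy frE; split=> [|_]; exact: leNye.
have fs_fin : (f sigma < +oo)%E by rewrite ltey.
have [fs fsE] : exists fs, f sigma = fs%:E.
  exists (fine (f sigma)); rewrite fineK// fin_numE.
  by rewrite (gt_eqF (f_proper _ S0sigma)) fs_neqy.
have [ftn ftnE] := component_fin _ _ _ S0tn S0rn sigmaE fs_fin.
have ep1 : 0 < 1 + eps by lra.
(* Dividing [eps tn + rho = eps tp + sigma] by its trace [1 + eps] turns it into an equality of
   mixtures with weights [p] and [1 - p]. *)
pose p := eps / (1 + eps).
have p01 : 0 <= p <= 1.
  apply/andP; split; first by rewrite divr_ge0// ltW.
  by rewrite ler_pdivrMr// mul1r; lra.
have qE : 1 - p = (1 + eps)^-1 by rewrite /p; field; rewrite gt_eqF.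
have mixE : p%:C *: tn + (1 - p)%:C *: rho = p%:C *: tp + (1 - p)%:C *: sigma.
  have [/andP[p0 p1]] := p01; have q0 : 0 <= 1 - p by lra.
  have pos T : Q T -> positive_operator dot T by move=> [[]].
  apply: (@positive_ext _ _ dot) => [||x].
  - by apply: positive_operator_lincomb => //; exact: pos.
  - by apply: positive_operator_lincomb => //; exact: pos.
  rewrite !quad_lincomb; try exact: pos.
  (* Both remainders are the integral against the common part [m]. *)
  have : quad dot rho x - eps * quad dot tp x =
      quad dot sigma x - eps * quad dot tn x.
    by apply: EFin_inj; rewrite rhoq sigmaq.
  move=> /(canRL (subrK _)) ->; rewrite qE /p; field.
  by rewrite gt_eqF.
have main : fr - fs <= eps * (ftp - ftn) + D_term a b eps.
  have := f_concave tn rho p S0tn S0rho p01; rewrite mixE => /le_trans.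
  move=> /(_ _ (f_convex tp sigma p S0tp S0sigma p01)).
  rewrite ftpE ftnE frE fsE -!EFinM -!EFinD lee_fin qE /D_term -/p => ineq.
  (* The inequality between the mixtures is multiplied by [1 + eps], which turns the weights [p] and
     [1 - p] into [eps] and 1. *)
  have -> : fr - fs = (1 + eps) * ((1 + eps)^-1 * fr - (1 + eps)^-1 * fs).
    by field; rewrite gt_eqF.
  have -> : eps * (ftp - ftn) = (1 + eps) * (p * ftp - p * ftn).
    by rewrite /p; field; rewrite gt_eqF.
  by rewrite -mulrDr ler_pM2l//; lra.
rewrite frE fsE -EFinB; split=> [|f_ge0].
  apply: (@le_trans _ _ (eps%:E * (f tp - f tn) + (D_term a b eps)%:E)%E).
    by rewrite ftpE ftnE -EFinB -EFinM -EFinD lee_fin.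
  rewrite leeD2r// lee_pmul2l//; apply: ereal_sup_ubound.
  by exists (tp, tn).
apply: (@le_trans _ _ (eps%:E * f tp + (D_term a b eps)%:E)%E).
  rewrite ftpE -EFinM -EFinD lee_fin (le_trans main)// lerD2r ler_pM2l//.
  by have := f_ge0 _ S0tn; rewrite ftnE lee_fin => ?; lra.
rewrite leeD2r// lee_pmul2l//; apply: ereal_sup_ubound.
by exists tp.
Qed.
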